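(* Let $d_n$ be a sequence of directed metrics of negative sign on $\mathbb{R}^2$ whose hypographs converge in $\mathcal{E}_*$ to the hypograph of a spacetime metric $d$. Let $(u_n;v_n)\to(u;v)\in\mathbb{R}^4_\uparrow$. Suppose that $\Gamma_n$ is a sequence of $d_n$-geodesics from $u_n$ to $v_n$ which are connected subsets of $\mathbb{R}^2$, and that $$d_n(u_n,v_n)\to d(u,v).$$ Then the sequence of closures $\bar\Gamma_n$ is precompact in the Hausdorff topology and all subsequential limits of $\bar\Gamma_n$ are $d$-geodesics from $u$ to $v$.
   Context: A directed metric of negative sign on $\mathbb{R}^2$ is $d:\mathbb{R}^2\times\mathbb{R}^2\to\mathbb{R}\cup\{-\infty\}$ with $d(p,p)=0$ and $d(p,r)\ge d(p,q)+d(q,r)$. For $d(p,q)>-\infty$, a $d$-geodesic set from $p$ to $q$ is a set $A\subset\mathbb{R}^2$ containing $p,q$ admitting a total order $\preceq$ with least element $p$, greatest element $q$ and $d(a,c)=d(a,b)+d(b,c)$ for all $a\preceq b\preceq c$ in $A$; a $d$-geodesic is a geodesic set from $p$ to $q$ maximal under inclusion. $\mathbb{R}^4_\uparrow=\{(x,s;y,t)\in\mathbb{R}^4:s<t\}$, $\mathbb{R}^4_\circ=\{(p,q)\in\mathbb{R}^2\times\mathbb{R}^2:p\ne q\}$, $\bar{\mathbb{R}}=[-\infty,\infty]$. Spacetime metric: a directed metric $d$ of negative sign on $\mathbb{R}^2$, continuous on $\mathbb{R}^4_\circ$ (with values in $\bar{\mathbb{R}}$), such that (1) $d>-\infty$ on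 $\mathbb{R}^4_\uparrow$, $d=0$ on the diagonal $\{(p,p)\}$, and $d=-\infty$ everywhere else; (2) for all $s<r<t$ and $x,y\in\mathbb{R}$, $d(x,s;y,t)=\max_{z\in\mathbb{R}}d(x,s;z,r)+d(z,r;y,t)$; (3) for any $(x,s;y,t)\in\mathbb{R}^4_\uparrow$ there is a compact set $[a,b]\times[s,t]$ containing all geodesics from $(x,s)$ to $(y,t)$. Hypograph convergence in $\mathcal{E}_*$: for $f:\mathbb{R}^4_\circ\to\bar{\mathbb{R}}$, $\mathfrak{h}f$ is the closure of $\{(r,a):a\le f(r)\}$ in $\mathbb{R}^4_\circ\times\bar{\mathbb{R}}$; with $E(r,a)=(r,|p-q|e^{-|r|}a/(1+|a|))$, $r=(p,q)$ ($a/(1+|a|)=\pm1$ at $\pm\infty$), $\mathfrak{h}f_n\to\mathfrak{h}f$ if the Hausdorff distance between $E(\mathfrak{h}f_n)$ and $E(\mathfrak{h}f)$ tends to $0$. *)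

(* Defs.v *)
(* A point of the plane is a pair (x, s) : R * R, with x the
   spatial coordinate and s the time coordinate. *)
From HB Require Import structures.
From mathcomp Require Import all_boot all_order all_algebra.
From mathcomp Require Import all_classical all_reals all_analysis.
From mathcomp Require Import ring lra.
Import Order.TTheory GRing.Theory Num.Theory.
Import numFieldNormedType.Exports.

Set Implicit Arguments.
Unset Strict Implicit.
Unset Printing Implicit Defensive.

Local Open Scope classical_set_scope.
Local Open Scope ring_scope.

Section directed_metrics.
Variable R : realType.
Implicit Types (d : R * R -> R * R -> \bar R) (p q : R * R) (A B : set (R * R)).

Definition directed_metric d : Prop :=
  [/\ (forall p q, d p q <> +oo%E),
      (forall p, d p p = 0%E) &
      (forall p q r, (d p q + d q r <= d p r)%E)].

Definition total_order_on A (le : R * R -> R * R -> Prop) : Prop :=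
  [/\ (forall a, A a -> le a a),
      (forall a b, A a -> A b -> le a b -> le b a -> a = b),
      (forall a b c, A a -> A b -> A c -> le a b -> le b c -> le a c) &
      (forall a b, A a -> A b -> le a b \/ le b a)].

Definition geodesic_set d p q A : Prop :=
  [/\ (-oo < d p q)%E, A p, A q &
      exists le : R * R -> R * R -> Prop,
        [/\ total_order_on A le,
            (forall a, A a -> le p a),
            (forall a, A a -> le a q) &
            (forall a b c, A a -> A b -> A c -> le a b -> le b c ->
               d a c = (d a b + d b c)%E)]].

Definition geodesic d p q A : Prop :=
  geodesic_set d p q A /\
  (forall B, geodesic_set d p q B -> A `<=` B -> B = A).

Definition offdiag : set ((R * R) * (R * R)) := [set r | r.1 <> r.2].

Record spacetime_metric d : Prop := SpacetimeMetric {
  spacetime_directed : directed_metric d;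
  spacetime_continuous : {within offdiag, continuous (fun r => d r.1 r.2)};
  spacetime_fin : forall p q, p.2 < q.2 -> (-oo < d p q)%E;
  spacetime_diag : forall p, d p p = 0%E;
  spacetime_ninfty : forall p q, p <> q -> q.2 <= p.2 -> d p q = -oo%E;
  spacetime_max : forall x s y t r : R, s < r -> r < t ->
    (forall z, (d (x, s) (z, r) + d (z, r) (y, t) <= d (x, s) (y, t))%E) /\
    (exists z, d (x, s) (y, t) = (d (x, s) (z, r) + d (z, r) (y, t))%E);
  spacetime_geodesics : forall x s y t : R, s < t -> exists a b : R,
    forall A, geodesic d (x, s) (y, t) A -> A `<=` `[a, b] `*` `[s, t]
}.

End directed_metrics.

(* The library's norm on a product is the sup norm, so the Euclidean norms of
   R^2, R^4 and R^5 are defined here. *)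
Section euclidean_norms.
Variable R : realType.

Definition enorm2 (p : R * R) : R := Num.sqrt (p.1 ^+ 2 + p.2 ^+ 2).

Definition enorm4 (r : (R * R) * (R * R)) : R :=
  Num.sqrt (r.1.1 ^+ 2 + r.1.2 ^+ 2 + r.2.1 ^+ 2 + r.2.2 ^+ 2).

Definition enorm5 (w : ((R * R) * (R * R)) * R) : R :=
  Num.sqrt (w.1.1.1 ^+ 2 + w.1.1.2 ^+ 2 + w.1.2.1 ^+ 2 + w.1.2.2 ^+ 2
            + w.2 ^+ 2).

Definition edist2 (p q : R * R) : R := enorm2 (p - q).

Definition edist5 (v w : ((R * R) * (R * R)) * R) : R := enorm5 (v - w).

End euclidean_norms.

Section hausdorff_distance.
Variables (R : realType) (T : Type) (dist : T -> T -> R).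
Implicit Types A B : set T.

Definition thickening (e : R) A : set T :=
  [set x | exists2 a, A a & dist x a <= e].

(* +oo when there is no such e, e.g., when exactly one of A, B is empty *)
Definition hausdorff_dist A B : \bar R :=
  ereal_inf [set e%:E | e in
    [set e : R | [/\ 0 <= e, A `<=` thickening e B & B `<=` thickening e A]]].

Lemma hausdorff_dist_ltP A B (e : R) :
  (hausdorff_dist A B < e%:E)%E <->
  exists r : R, [/\ 0 <= r, r < e, A `<=` thickening r B
                  & B `<=` thickening r A].
Proof.
split.
  by case/ereal_inf_lt => _ [r [r0 AB BA] <-]; rewrite lte_fin => re; exists r.
case=> r [r0 re AB BA]; apply: (@le_lt_trans _ _ r%:E); last by rewrite lte_fin.
by apply: ereal_inf_lbound; exists r.
Qed.

Lemma hausdorff_dist_sym A B : hausdorff_dist A B = hausdorff_dist B A.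
Proof.
rewrite /hausdorff_dist; congr (ereal_inf (image _ _)).
by apply/seteqP; split=> r /= [].
Qed.

Lemma hausdorff_dist_lt_center A (e : R) : (forall x, dist x x = 0) ->
  0 < e -> (hausdorff_dist A A < e%:E)%E.
Proof.
move=> d0 e0; apply/hausdorff_dist_ltP; exists 0.
by split=> // x Ax; exists x => //; rewrite d0.
Qed.

Lemma hausdorff_dist_lt_triangle A B C (e1 e2 : R) :
  (forall x y z, dist x z <= dist x y + dist y z) ->
  (hausdorff_dist A B < e1%:E)%E -> (hausdorff_dist B C < e2%:E)%E ->
  (hausdorff_dist A C < (e1 + e2)%:E)%E.
Proof.
move=> dtri /hausdorff_dist_ltP[r1 [r10 re1 AB BA]].
move=> /hausdorff_dist_ltP[r2 [r20 re2 BC CB]].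
apply/hausdorff_dist_ltP; exists (r1 + r2); split.
- exact: addr_ge0.
- exact: ltrD.
- move=> x /AB[y By xy]; have [z Cz yz] := BC _ By.
  by exists z => //; apply: le_trans (dtri x y z) _; exact: lerD.
- move=> x /CB[y By xy]; have [z Az yz] := BA _ By.
  exists z => //; apply: le_trans (dtri x y z) _.
  by rewrite addrC; exact: lerD.
Qed.

End hausdorff_distance.

Section hypographs.
Variable R : realType.
Implicit Types (d : R * R -> R * R -> \bar R).

(* closure relative to offdiag `*` setT, i.e., in R^4_o x [-oo, +oo] *)
Definition hypograph d : set (((R * R) * (R * R)) * \bar R) :=
  [set w | offdiag w.1] `&`
  closure [set w | offdiag w.1 /\ (w.2 <= d w.1.1 w.1.2)%E].

(* contract a = a / (1 + |a|), with contract +oo = 1 and contract -oo = -1 *)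
Definition hypo_embed (w : ((R * R) * (R * R)) * \bar R) :
    ((R * R) * (R * R)) * R :=
  (w.1, edist2 w.1.1 w.1.2 * expR (- enorm4 w.1) * contract w.2).

Definition hypo_cvg (d_ : nat -> R * R -> R * R -> \bar R) d : Prop :=
  hausdorff_dist (@edist5 R) (hypo_embed @` hypograph (d_ n))
    (hypo_embed @` hypograph d) @[n --> \oo] --> 0%E.

End hypographs.

Section edist2_metric.
Variable R : realType.
Implicit Types p q r : R * R.

Lemma edist2xx p : edist2 p p = 0.
Proof. by rewrite /edist2 /enorm2 subrr /= expr0n addr0 sqrtr0. Qed.

Lemma edist2_sym p q : edist2 p q = edist2 q p.
Proof.
rewrite /edist2 /enorm2 /=; congr Num.sqrt.
by rewrite -[p.1 - _]opprB -[p.2 - _]opprB !sqrrN.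
Qed.

Lemma enorm2D p q : enorm2 (p + q) <= enorm2 p + enorm2 q.
Proof.
case: p q => [a b] [u v]; rewrite /enorm2 /=.
set s := a ^+ 2 + b ^+ 2; set t := u ^+ 2 + v ^+ 2.
have s0 : 0 <= s by rewrite addr_ge0// sqr_ge0.
have t0 : 0 <= t by rewrite addr_ge0// sqr_ge0.
rewrite -(@ger0_norm _ (Num.sqrt s + _)) ?addr_ge0 ?sqrtr_ge0//.
rewrite -sqrtr_sqr ler_wsqrtr// [leRHS]sqrrD !sqr_sqrtr// -sqrtrM//.
suff : a * u + b * v <= Num.sqrt (s * t) by move: (Num.sqrt _) => w; rewrite /s /t mulr2n; nra.
apply: le_trans (ler_norm _) _; rewrite -sqrtr_sqr ler_wsqrtr// /s /t.
by have := sqr_ge0 (a * v - b * u); nra.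
Qed.

Lemma edist2_triangle p q r : edist2 p r <= edist2 p q + edist2 q r.
Proof.
by rewrite /edist2 (_ : p - r = (p - q) + (q - r)) ?enorm2D// addrA subrK.
Qed.

End edist2_metric.

(* The space of closed subsets of the plane with the Hausdorff topology, as the
   pseudometric space with balls {L | hausdorff_dist K L < e}. The distance may
   be +oo, so that unbounded sets are allowed. The empty set is included but is
   an isolated point. *)
Record hyperspace (R : realType) := Hyperspace {
  hyperspace_set :> set (R * R);
  hyperspace_closed : closed hyperspace_set
}.

HB.instance Definition _ (R : realType) := gen_eqMixin (hyperspace R).
HB.instance Definition _ (R : realType) := gen_choiceMixin (hyperspace R).

Module HyperspaceMetric.
Section hyperspace_metric.
Variable R : realType.
Implicit Types K L M : hyperspace R.

Definition ball K (e : R) : set (hyperspace R) :=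
  [set L | (hausdorff_dist (@edist2 R) K L < e%:E)%E].

Definition ent : set_system (hyperspace R * hyperspace R) := entourage_ ball.

Definition nbhs K : set_system (hyperspace R) := nbhs_ ent K.

Lemma nbhsE : nbhs = nbhs_ ent. Proof. by []. Qed.

#[export] HB.instance Definition _ := hasNbhs.Build (hyperspace R) nbhs.

Lemma ball_center K (e : R) : 0 < e -> ball K e K.
Proof. by move=> e0; apply: hausdorff_dist_lt_center => //; exact: edist2xx. Qed.

Lemma ball_sym K L (e : R) : ball K e L -> ball L e K.
Proof. by rewrite /ball /= hausdorff_dist_sym. Qed.

Lemma ball_triangle K L M (e1 e2 : R) :
  ball K e1 L -> ball L e2 M -> ball K (e1 + e2) M.
Proof. by apply: hausdorff_dist_lt_triangle; exact: edist2_triangle. Qed.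

Lemma entourageE : ent = entourage_ ball. Proof. by []. Qed.

#[export] HB.instance Definition _ := @Nbhs_isPseudoMetric.Build R (hyperspace R)
  ent nbhsE ball ball_center ball_sym ball_triangle entourageE.

End hyperspace_metric.
Module Exports. HB.reexport. End Exports.
End HyperspaceMetric.
Export HyperspaceMetric.Exports.

Definition hyper_closure (R : realType) (A : set (R * R)) : hyperspace R :=
  Hyperspace (@closed_closure _ A).

(* Main.v *)
(* Hypograph convergence makes [d_ n] jointly upper semicontinuous in the limit,
   away from the diagonal: if [p <> q] and [d p q < c], then [d_ n p' q' < c] for
   large [n] and [(p', q')] close to [(p, q)]. Hence a limit point [z] of points
   of [Gamma n] satisfies [d u z + d z v >= d u v], so it lies on a [d]-geodesic
   from [u] to [v]. As these geodesics stay in a compact box, no limit point lies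
   on a large sphere, and by connectedness [Gamma n] cannot cross this sphere.
   This gives boundedness, and Blaschke's selection theorem gives precompactness.
   The same semicontinuity along chains [u, a, b, c, v] shows that a limit set is
   a geodesic set ordered by time. It is maximal because, by connectedness, it has
   a point at each time in [u.2, v.2], while a [d]-geodesic set has at most one. *)
Require Import Defs.
From mathcomp Require Import all_boot all_order all_algebra.
From mathcomp Require Import all_classical all_reals all_analysis.
From mathcomp Require Import lra.
Import Order.TTheory GRing.Theory Num.Theory.
Import numFieldNormedType.Exports.

Set Implicit Arguments.
Unset Strict Implicit.
Unset Printing Implicit Defensive.

Local Open Scope classical_set_scope.
Local Open Scope ring_scope.

(** * Euclidean norms compared with the product topology *)

Lemma le_sqrt_norm (R : realType) (x y : R) : x ^+ 2 <= y -> `|x| <= Num.sqrt y.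
Proof. by move=> xy; rewrite -sqrtr_sqr ler_wsqrtr. Qed.

Lemma norm_le_enorm5 (R : realType) (w : ((R * R) * (R * R)) * R) :
  [/\ `|w.1.1.1| <= enorm5 w, `|w.1.1.2| <= enorm5 w, `|w.1.2.1| <= enorm5 w,
      `|w.1.2.2| <= enorm5 w & `|w.2| <= enorm5 w].
Proof.
case: w => [[[a b] [x y]] z]; rewrite /enorm5 /=.
have := (sqr_ge0 a, sqr_ge0 b, sqr_ge0 x, sqr_ge0 y, sqr_ge0 z).
move=> [[[[? ?] ?] ?] ?].
by split; apply: le_sqrt_norm; lra.
Qed.

Lemma norm_le_enorm2 (R : realType) (p : R * R) :
  `|p.1| <= enorm2 p /\ `|p.2| <= enorm2 p.
Proof.
case: p => a b; rewrite /enorm2 /=.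
have := (sqr_ge0 a, sqr_ge0 b) => -[? ?].
by split; apply: le_sqrt_norm; lra.
Qed.

Lemma enorm2_lt (R : realType) (e : R) (p : R * R) : 0 < e ->
  `|p.1| < e / 2 -> `|p.2| < e / 2 -> enorm2 p < e.
Proof.
case: p => a b e0 /= ae be; rewrite /enorm2 /=.
rewrite -[ltRHS](ger0_norm (ltW e0)) -sqrtr_sqr ltr_sqrt ?exprn_gt0//.
rewrite -[a ^+ 2]real_normK ?num_real// -[b ^+ 2]real_normK ?num_real//.
have := normr_ge0 a; have := normr_ge0 b; nra.
Qed.

Lemma ball_edist2 (R : realType) (e : R) (p q : R * R) :
  edist2 p q < e -> ball p e q.
Proof.
move=> pq; have [h1 h2] := norm_le_enorm2 (p - q).
by split; [apply: le_lt_trans h1 _ | apply: le_lt_trans h2 _].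
Qed.

Lemma edist2_ball (R : realType) (e : R) (p q : R * R) : 0 < e ->
  ball p (e / 2) q -> edist2 p q < e.
Proof. by move=> e0 [h1 h2]; exact: enorm2_lt. Qed.

Lemma edist2_gt0 (R : realType) (p q : R * R) : p <> q -> 0 < edist2 p q.
Proof.
move=> pq; rewrite lt_neqAle sqrtr_ge0 andbT eq_sym; apply/negP => /eqP h.
have [] := norm_le_enorm2 (p - q); rewrite -/(edist2 p q) h !normr_le0 !subr_eq0.
by case: p q pq {h} => [a b] [x y] pq /= /eqP ? /eqP ?; apply: pq; congr pair.
Qed.

(** * Upper semicontinuity from hypograph convergence *)

Definition hypo_weight (R : realType) (r : (R * R) * (R * R)) : R :=
  edist2 r.1 r.2 * expR (- enorm4 r).

Lemma hypo_weight_gt0 (R : realType) (r : (R * R) * (R * R)) :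
  offdiag r -> 0 < hypo_weight r.
Proof. by move=> /edist2_gt0 r0; rewrite mulr_gt0 ?expR_gt0. Qed.

Lemma hypo_weight_continuous (R : realType) : continuous (@hypo_weight R).
Proof.
move=> [[a b] [x y]].
have sq (F : (R * R) * (R * R) -> R) r : {for r, continuous F} ->
  {for r, continuous (fun r => F r ^+ 2)}.
  by move=> cF; apply: (@continuous_comp _ _ _ F (fun x => x ^+ 2)) => //; exact: exprn_continuous.
have c1 : forall r, {for r, continuous (fun r : (R * R) * (R * R) => r.1.1)}.
  by move=> r; apply: (@continuous_comp _ _ _ fst fst) => //; exact: cvg_fst.
have c2 : forall r, {for r, continuous (fun r : (R * R) * (R * R) => r.1.2)}.
  by move=> r; apply: (@continuous_comp _ _ _ fst snd) => //; [exact: cvg_fst|exact: cvg_snd].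
have c3 : forall r, {for r, continuous (fun r : (R * R) * (R * R) => r.2.1)}.
  by move=> r; apply: (@continuous_comp _ _ _ snd fst) => //; [exact: cvg_snd|exact: cvg_fst].
have c4 : forall r, {for r, continuous (fun r : (R * R) * (R * R) => r.2.2)}.
  by move=> r; apply: (@continuous_comp _ _ _ snd snd) => //; exact: cvg_snd.
apply: cvgM.
  apply: (@continuous_comp _ _ _ (fun r : (R * R) * (R * R) =>
     (r.1.1 - r.2.1) ^+ 2 + (r.1.2 - r.2.2) ^+ 2) Num.sqrt); last exact: sqrt_continuous.
  by apply: cvgD; apply: sq; apply: cvgB; [exact: c1|exact: c3|exact: c2|exact: c4].
apply: (@continuous_comp _ _ _ (fun r : (R * R) * (R * R) => - enorm4 r) expR);
  last exact: continuous_expR.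
apply: cvgN.
apply: (@continuous_comp _ _ _ (fun r : (R * R) * (R * R) =>
     r.1.1 ^+ 2 + r.1.2 ^+ 2 + r.2.1 ^+ 2 + r.2.2 ^+ 2) Num.sqrt); last exact: sqrt_continuous.
by do 3?[apply: cvgD]; apply: sq; [exact: c1|exact: c2|exact: c3|exact: c4].
Qed.

Lemma offdiag_open (R : realType) : open (@offdiag R).
Proof.
have -> : @offdiag R = (fun r => edist2 r.1 r.2 * expR (- enorm4 r)) @^-1` [set x | 0 < x].
  apply/seteqP; split=> r /=; first exact: hypo_weight_gt0.
  move=> + rr; rewrite rr edist2xx mul0r ltxx; by [].
by apply: open_comp; [move=> r _; exact: hypo_weight_continuous | exact: open_gt].
Qed.

(** The bound holds on a whole neighbourhood, so taking the closure cannot lift a point above it. *)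
Lemma hypograph_le (R : realType) (d : R * R -> R * R -> \bar R)
    (w : ((R * R) * (R * R)) * \bar R) (c : \bar R) :
  (\forall r \near w.1, (d r.1 r.2 < c)%E) -> hypograph d w -> (w.2 <= c)%E.
Proof.
case: w => r a /= dc [/= _ acl]; rewrite leNgt; apply/negP => ca.
have nb : nbhs (r, a) ([set s | (d s.1 s.2 < c)%E] `*` [set x | (c < x)%E]).
  by exists ([set s | (d s.1 s.2 < c)%E], [set x | (c < x)%E]) => //; split => //=; exact: open_ereal_gt'.
have [[s x] [[/= _ xd] [/= dsc cx]]] := acl _ nb.
by have := lt_le_trans cx (le_trans xd (ltW dsc)); rewrite ltxx.
Qed.

Lemma ereal_real_between (R : realType) (x : \bar R) (c : R) : (x < c%:E)%E ->
  exists2 c', (x < c'%:E)%E & c' < c.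
Proof.
case: x => [x h|//|_]; last by exists (c - 1); rewrite ?ltNyr ?ltrBlDr ?ltrDl.
by move: h; rewrite lte_fin => h; exists ((x + c) / 2); rewrite ?lte_fin; lra.
Qed.

(* Upper semicontinuity, jointly in the metric and in the points: a value of
   [d_ n] at least [c] close to [r] would put [(r, c)] in the hypograph of
   [d_ n], hence close to the hypograph of [d], where heights are below [c]. *)
Lemma hypo_cvg_usc (R : realType) (d_ : nat -> R * R -> R * R -> \bar R)
    (d : R * R -> R * R -> \bar R) (r0 : (R * R) * (R * R)) (c : R) :
  {within @offdiag R, continuous (fun r => d r.1 r.2)} -> hypo_cvg d_ d ->
  offdiag r0 -> (d r0.1 r0.2 < c%:E)%E ->
  \forall r \near r0 & n \near \oo, (d_ n r.1 r.2 < c%:E)%E.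
Proof.
move=> dcont hcvg r0off /ereal_real_between[c' dc' c'c].
pose k := contract c%:E; pose k' := contract c'%:E.
have kk' : k' < k by rewrite lt_contract lte_fin.
(* The gap between the last coordinates of the embeddings of [(w.1, c)] and [(w.2, c')]. *)
pose h (w : ((R * R) * (R * R)) * ((R * R) * (R * R))) :=
  hypo_weight w.1 * k - hypo_weight w.2 * k'.
have h0 : 0 < h (r0, r0).
  by rewrite /h /= -mulrBr mulr_gt0 ?subr_gt0 ?hypo_weight_gt0.
have hcont : {for (r0, r0), continuous h}.
  by apply: cvgB; (apply: cvgM; last exact: cvg_cst);
    [apply: (@continuous_comp _ _ _ fst (@hypo_weight R)) |
     apply: (@continuous_comp _ _ _ snd (@hypo_weight R))];
    by [exact: cvg_fst | exact: cvg_snd | exact: hypo_weight_continuous].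
have /nbhs_ballP[e1 /= e10 he1] : nbhs (r0, r0) [set w | h (r0, r0) / 2 < h w].
  by apply: (hcont [set y | h (r0, r0) / 2 < y]); apply: lt_nbhsr; lra.
(* The interior makes [d < c'] hold around every point of the ball, as [hypograph_le] requires. *)
have /nbhs_ballP[e2 /= e20 he2] : nbhs r0 [set r | @offdiag R r /\ (d r.1 r.2 < c'%:E)%E]^°.
  apply: nbhs_interior.
  apply: filterI; first by apply: open_nbhs_nbhs; split => //; exact: offdiag_open.
  move: dcont; rewrite continuous_open_subspace; last exact: offdiag_open.
  move=> /(_ r0 (mem_set r0off)) cd; apply: (cd [set x | (x < c'%:E)%E]).
  exact: open_ereal_lt'.
pose e := Num.min e1 e2.
have e_gt0 : 0 < e by rewrite lt_min e10 e20.
have [ee1 ee2] : e <= e1 /\ e <= e2 by rewrite !ge_min !lexx orbT.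
(* The first term keeps the base points within [e] of [r0]; the second is half the gap at [r0],
   which [h] exceeds nearby. *)
pose eps := Num.min (e / 2) (h (r0, r0) / 2).
have eps0 : 0 < eps by rewrite lt_min !divr_gt0.
have hn : \forall n \near \oo, (hausdorff_dist (@edist5 R) (@hypo_embed R @` hypograph (d_ n))
    (@hypo_embed R @` hypograph d) < eps%:E)%E.
  by apply: (hcvg [set x | (x < eps%:E)%E]); apply: open_ereal_lt'; rewrite lte_fin.
exists (ball r0 (e / 2), [set n | (hausdorff_dist (@edist5 R)
    (@hypo_embed R @` hypograph (d_ n)) (@hypo_embed R @` hypograph d) < eps%:E)%E]).
  by split => //=; apply: nbhsx_ballx; rewrite divr_gt0.
case=> r n /= [r0r /hausdorff_dist_ltP[rho [rho0 rhoe AB _]]].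
have r0re : ball r0 e r by apply: le_ball r0r; lra.
have [roff _] := interior_subset (he2 _ (le_ball ee2 r0re)).
rewrite ltNge; apply/negP => cd.
have [] := AB (@hypo_embed R (r, c%:E)).
  by exists (r, c%:E) => //; split => //; apply: subset_closure.
move=> _ [[r2 a] wd <-].
have := norm_le_enorm5 (hypo_embed (r, c%:E) - hypo_embed (r2, a)).
rewrite -/(edist5 _ _) /= => -[n1 n2 n3 n4 n5] le_rho.
have lt_eps x : x <= edist5 (hypo_embed (r, c%:E)) (hypo_embed (r2, a)) -> x < e / 2.
  by move=> /le_trans/(_ le_rho)/le_lt_trans/(_ rhoe)/lt_le_trans; apply; rewrite ge_min lexx.
have rr2 : ball r (e / 2) r2.
  by split; split; apply: lt_eps.
have r0r2 : ball r0 e r2 by rewrite (splitr e); exact: ball_triangle r0r rr2.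
have hlt : h (r0, r0) / 2 < h (r, r2) by apply: he1; split; exact: le_ball ee1 _ _.
(* Heights over [r2] are at most [c'], so the last coordinates differ by at least [h (r, r2)]. *)
have : h (r, r2) <= h (r0, r0) / 2.
  apply: (@le_trans _ _ eps); last by rewrite ge_min lexx orbT.
  apply: (le_trans _ (le_trans (le_trans n5 le_rho) (ltW rhoe))).
  apply: (le_trans _ (ler_norm _)).
  rewrite /h /= /hypo_weight -/k lerD2l lerN2.
  rewrite ler_wpM2l ?mulr_ge0 ?expR_ge0 ?sqrtr_ge0//.
  rewrite /k' le_contract.
  apply: (@hypograph_le _ d (r2, a)) => //=.
  by apply: filterS (he2 _ (le_ball ee2 r0r2)) => ? [].
by rewrite leNgt hlt.
Qed.

(** * The Hausdorff topology on closed subsets of the plane *)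

Lemma edist2_lt_closed (R : realType) (K : set (R * R)) (x : R * R) : closed K ->
  (forall e, 0 < e -> exists2 y, K y & edist2 x y < e) -> K x.
Proof.
move=> Kcl xK; apply: Kcl => V /nbhs_ballP[e /= e0 eV].
by have [y Ky xy] := xK _ e0; exists y; split => //; apply: eV; exact: ball_edist2.
Qed.

Lemma edist2_lt_closure (R : realType) (K : set (R * R)) (x : R * R) (e : R) :
  closure K x -> 0 < e -> exists2 y, K y & edist2 x y < e.
Proof.
move=> Kx e0; have e20 : 0 < e / 2 by rewrite divr_gt0.
have [y [Ky xy]] := Kx _ (nbhsx_ballx x _ e20).
by exists y => //; exact: edist2_ball.
Qed.

Lemma near_edist2 (R : realType) (x : R * R) (e : R) : 0 < e ->
  \forall y \near x, edist2 x y < e.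
Proof.
move=> e0; have e20 : 0 < e / 2 by rewrite divr_gt0.
by apply: filterS (nbhsx_ballx x _ e20) => y; exact: edist2_ball.
Qed.

Lemma hyperspace_eq (R : realType) (K L : hyperspace R) :
  hyperspace_set K = hyperspace_set L -> K = L.
Proof.
case: K L => [K Kc] [L Lc] /= KL; move: Kc Lc; rewrite KL => Kc Lc.
by congr Hyperspace; exact: Prop_irrelevance.
Qed.

Lemma hyperspace_ballP (R : realType) (K L : hyperspace R) (e : R) :
  ball K e L <-> exists r, [/\ 0 <= r, r < e, K `<=` thickening (@edist2 R) r L
                              & L `<=` thickening (@edist2 R) r K].
Proof. exact: hausdorff_dist_ltP. Qed.

(** If neighbourhoods of [K] and [L] always meet, some [M] is close to both, so each point of [K] is
    a limit of points of the closed set [L]. *)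
Lemma hyperspace_hausdorff (R : realType) : hausdorff_space (hyperspace R).
Proof.
suff sub (K L : hyperspace R) : cluster (nbhs K) L -> K `<=` L.
  move=> K L KL; apply: hyperspace_eq; apply/seteqP; split; first exact: sub.
  by apply: sub => U V /KL LU /LU; rewrite setIC.
move=> KL x Kx; apply: (edist2_lt_closed (@hyperspace_closed _ L)) => e e0.
have e20 : 0 < e / 2 by rewrite divr_gt0.
have [M [/hyperspace_ballP[r [_ re KM _]] /hyperspace_ballP[s [_ se _ ML]]]] :=
  KL _ _ (nbhsx_ballx K _ e20) (nbhsx_ballx L _ e20).
have [y My xy] := KM _ Kx; have [z Lz yz] := ML _ My.
by exists z => //; apply: le_lt_trans (edist2_triangle x y z) _; lra.
Qed.

(* Blaschke's selection theorem. The limit of an ultrafilter [F] consists of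
   the points all of whose neighbourhoods meet [F]-almost every set. *)
Lemma compact_hyperspace_sub (R : realType) (B : set (R * R)) : compact B ->
  compact [set L : hyperspace R | L `<=` B].
Proof.
move=> Bco; rewrite compact_ultra => F FU FB.
pose K : set (R * R) := [set x | forall e, 0 < e ->
  F [set L : hyperspace R | exists2 y, hyperspace_set L y & edist2 x y < e]].
have Kcl : closed K.
  move=> x Kx e e0; have e20 : 0 < e / 2 by rewrite divr_gt0.
  have [y Ky xy] := edist2_lt_closure Kx e20.
  apply: filterS (Ky _ e20) => L [z Lz yz]; exists z => //.
  by apply: le_lt_trans (edist2_triangle x y z) _; lra.
have Bcl : closed B by apply: compact_closed => //; exact: norm_hausdorff.
have KB : K `<=` B.
  move=> x Kx; apply: (edist2_lt_closed Bcl) => e e0.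
  have [L [LB [y Ly xy]]] := filter_ex (filterI FB (Kx _ e0)).
  by exists y => //; exact: LB.
have Kco : compact K by exact: subclosed_compact KB.
exists (Hyperspace Kcl); split => //=.
apply/fcvg_ballP => e e0.
have [e20 e40] : 0 < e / 2 /\ 0 < e / 4 by rewrite !divr_gt0.
(* Compactness of [K] makes the approximation by [F]-almost every [L] uniform. *)
have FK : \forall L \near F, forall y, K y -> exists2 a, hyperspace_set L a & edist2 y a <= e / 2.
  apply: ((compact_near_coveringP _).1 Kco _ F
    (fun (L : hyperspace R) y => exists2 a, hyperspace_set L a & edist2 y a <= e / 2)) => y Ky.
  exists ([set y' | edist2 y y' < e / 4], [set L : hyperspace R | exists2 a, hyperspace_set L a & edist2 y a < e / 4]).
    by split; [exact: near_edist2 | exact: Ky].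
  case=> y' L /= [yy' [a La ya]]; exists a => //.
  apply: le_trans (edist2_triangle y' y a) _; rewrite (edist2_sym y' y); lra.
(* The covering is over [B], which does not depend on [L]. Near a point of [K] that point serves; a
   point off [K] has a neighbourhood missed by [F]-almost every [L], as [F] is an ultrafilter. *)
have FL : \forall L \near F, forall y, B y -> hyperspace_set L y ->
    exists2 a, K a & edist2 y a <= e / 2.
  apply: ((compact_near_coveringP _).1 Bco _ F
    (fun (L : hyperspace R) y => hyperspace_set L y -> exists2 a, K a & edist2 y a <= e / 2)) => y By.
  have [Ky|nKy] := pselect (K y).
    exists ([set y' | edist2 y y' < e / 2], setT).
      by split; [exact: near_edist2 | exact: filterT].
    by case=> y' L /= [yy' _] _; exists y => //; rewrite edist2_sym ltW.
  have [s [s0 Fs]] : exists s, 0 < s /\ ~ F [set L : hyperspace R | exists2 a, hyperspace_set L a & edist2 y a < s].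
    by apply: contrapT => h; apply: nKy => s s0; apply: contrapT => Fs; apply: h; exists s.
  have [//|Fs'] := in_ultra_setVsetC [set L : hyperspace R | exists2 a, hyperspace_set L a & edist2 y a < s] FU.
  exists ([set y' | edist2 y y' < s], ~` [set L : hyperspace R | exists2 a, hyperspace_set L a & edist2 y a < s]).
    by split => //; exact: near_edist2.
  by case=> y' L /= [yy' h] Ly'; exfalso; apply: h; exists y'.
apply: filterS3 FB FK FL => L LB KL LK.
apply/hyperspace_ballP; exists (e / 2); split; first exact: ltW.
- by rewrite ltr_pdivrMr// ltr_pMr// ltr1n.
- exact: KL.
- by move=> x Lx; apply: LK => //; exact: LB.
Qed.

(** Early terms may leave [B], so these finitely many are adjoined to the compact set. *)
Lemma precompact_range (R : realType) (f : nat -> hyperspace R)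
    (B : set (R * R)) : compact B -> (\forall n \near \oo, f n `<=` B) ->
  precompact (range f).
Proof.
move=> Bco [N _ fB].
apply: (@precompact_subset _ _ ([set L : hyperspace R | L `<=` B] `|` f @` `I_N)).
  move=> _ [n _ <-]; have [nN|Nn] := ltnP n N; first by right; exists n.
  by left; exact: fB.
apply: compact_precompact; first exact: hyperspace_hausdorff.
apply: compactU; first exact: compact_hyperspace_sub.
by apply: finite_compact; apply: finite_image; exact: finite_II.
Qed.

(** * Lengths of paths under hypograph convergence *)

Lemma adde_gtNy (R : realType) (x y : \bar R) :
  (-oo < x + y)%E -> (-oo < x)%E /\ (-oo < y)%E.
Proof. by case: x => [x||]; case: y => [y||] //=; rewrite ?ltNyr ?ltNyy. Qed.

(** The value [+oo] is excluded because [-oo + +oo = -oo] lies below [c], yet no real lies above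
    [+oo]. *)
Lemma lt_adde_split (R : realType) (x y : \bar R) (c : R) :
  (x <> +oo -> y <> +oo -> x + y < c%:E ->
  exists c1 c2 : R, [/\ x < c1%:E, y < c2%:E & (c1 + c2)%R = c])%E.
Proof.
case: x => [x||//]; case: y => [y||//] //= _ _.
- rewrite -EFinD lte_fin => xyc.
  exists (x + (c - x - y) / 2), (y + (c - x - y) / 2).
  by rewrite !lte_fin; split; lra.
- by exists (x + 1), (c - (x + 1)); rewrite lte_fin ltNyr; split => //; lra.
- by exists (c - (y + 1)), (y + 1); rewrite lte_fin ltNyr; split => //; lra.
- by exists 0, c; rewrite !ltNyr add0r.
Qed.

Fixpoint path_length (R : realType) (d : R * R -> R * R -> \bar R) (p : R * R)
    (s : seq (R * R)) : \bar R :=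
  if s is q :: s' then (d p q + path_length d q s')%E else 0%E.

Lemma path_length_neqy (R : realType) (d : R * R -> R * R -> \bar R) p s :
  directed_metric d -> path_length d p s <> +oo%E.
Proof.
move=> [dy _ _]; elim: s p => [//|q s IHs] p /=.
have := dy p q; have := IHs q.
by case: (d p q) => [?||//]; case: (path_length d q s) => [?||].
Qed.

Lemma geodesic_set_path_length (R : realType) (d : R * R -> R * R -> \bar R)
    (A : set (R * R)) (le : R * R -> R * R -> Prop) p s :
  (forall a, d a a = 0%E) -> total_order_on A le ->
  (forall a b c, A a -> A b -> A c -> le a b -> le b c ->
     d a c = (d a b + d b c)%E) ->
  {in p :: s, forall x, A x} -> path (fun x y => `[< le x y >]) p s ->
  le p (last p s) /\ d p (last p s) = path_length d p s.
Proof.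
move=> d0 [rle _ tle _] dadd; elim: s p => [|q s IHs] p sA /=.
  by move=> _; split; [apply: rle; apply: sA; rewrite inE | exact: d0].
move=> /andP[/asboolP pq /IHs].
have qsA : {in q :: s, forall x, A x} by move=> x xs; apply: sA; rewrite inE xs orbT.
have Ap : A p by apply: sA; rewrite mem_head.
have Aq : A q by apply: qsA; rewrite mem_head.
have Al : A (last q s) by apply: qsA; exact: mem_last.
move=> /(_ qsA)[ql dql]; split; first exact: tle ql.
by rewrite (dadd _ _ _ Ap Aq Al) ?dql.
Qed.

Lemma uniq_path_neq (T : eqType) (x : T) s :
  uniq (x :: s) -> path (fun y z => y != z) x s.
Proof.
elim: s x => [//|y s IHs] x /= /and3P[]; rewrite inE negb_or => /andP[xy _] ys us.
by rewrite xy IHs //= ys.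
Qed.

Lemma filter_forall_seq (I : Type) (F : set_system I) {FF : Filter F}
    (T : eqType) (P : T -> I -> Prop) (s : seq T) :
  {in s, forall t, \forall i \near F, P t i} ->
  \forall i \near F, {in s, forall t, P t i}.
Proof.
elim: s => [|t s IHs] sP; first exact: nearW.
have := sP _ (mem_head _ _); have : \forall i \near F, {in s, forall t, P t i}.
  by apply: IHs => x xs; apply: sP; rewrite inE xs orbT.
by apply: filterS2 => i Ps Pt x; rewrite inE => /predU1P[->//|]; exact: Ps.
Qed.

(** The bound [c] is split among the steps of the path and [hypo_cvg_usc] is applied to each.
    Consecutive vertices must differ, since semicontinuity is available only off the diagonal. *)
Lemma hypo_cvg_path_usc (R : realType) (d_ : nat -> R * R -> R * R -> \bar R)
    (d : R * R -> R * R -> \bar R) p s (c : R) :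
  spacetime_metric d -> hypo_cvg d_ d ->
  path (fun x y => x != y) p s -> (path_length d p s < c%:E)%E ->
  \forall e \near 0^'+ & n \near \oo, forall f : R * R -> R * R,
    {in p :: s, forall x, ball x e (f x)} ->
    (path_length (d_ n) (f p) (map f s) < c%:E)%E.
Proof.
move=> hd hcvg; elim: s p c => [|q s IHs] p c /=; first by move=> _ c0; apply: (filterS _ filterT).
move=> /andP[/eqP pq qs] /lt_adde_split[||c1 [c2 [h1 h2 <-]]].
- by have [] := spacetime_directed hd.
- by apply: path_length_neqy; exact: spacetime_directed.
have [[U V] [/= /nbhs_ballP[e0 /= e00 eU] nV UV]] :=
  hypo_cvg_usc (spacetime_continuous hd) hcvg (r0 := (p, q)) pq h1.
have H1 : \forall e \near 0^'+ & n \near \oo, e < e0 /\ V n.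
  by exists ([set e | e < e0], V) => //; split => //; exact: nbhs_right_lt.
apply: filterS2 H1 (IHs _ _ qs h2) => -[e n] /= [ee0 Vn] IH f fe.
rewrite EFinD lteD//.
  apply: (UV ((f p, f q), n)); split => //; apply: eU.
  by split; apply: (le_ball (ltW ee0)); apply: fe; rewrite !inE eqxx ?orbT.
by apply: IH => x xs; apply: fe; rewrite inE xs orbT.
Qed.

Lemma hypo_cvg_path_lt (R : realType) (d_ : nat -> R * R -> R * R -> \bar R)
    (d : R * R -> R * R -> \bar R) (u_ v_ : nat -> R * R) (u v : R * R) s :
  spacetime_metric d -> hypo_cvg d_ d ->
  d_ n (u_ n) (v_ n) @[n --> \oo] --> d u v ->
  uniq (u :: s) -> (path_length d u s < d u v)%E ->
  \forall e \near 0^'+ & n \near \oo, forall f : R * R -> R * R,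
    {in u :: s, forall x, ball x e (f x)} ->
    (path_length (d_ n) (f u) (map f s) < d_ n (u_ n) (v_ n))%E.
Proof.
move=> hd hcvg hduv us lt_s.
(* A fixed real [c] in between also stays below [d_ n (u_ n) (v_ n)] for large [n]. *)
have [c lt_c c_lt] : exists2 c : R, (path_length d u s < c%:E)%E & (c%:E < d u v)%E.
  have [dy _ _] := spacetime_directed hd.
  case E : (d u v) (dy u v) lt_s => [r||]//; last by move=> _; rewrite ltNge leNye.
  by move=> _ /ereal_real_between[c h1 h2]; exists c; rewrite ?lte_fin.
have H1 : \forall e \near (0 : R)^'+ & n \near \oo, (c%:E < d_ n (u_ n) (v_ n))%E.
  exists (setT, [set n | (c%:E < d_ n (u_ n) (v_ n))%E]); last by case=> e n [].
  split; first exact: filterT.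
  by apply: (hduv [set x | (c%:E < x)%E]); exact: open_ereal_gt'.
apply: filterS2 H1 (hypo_cvg_path_usc hd hcvg (uniq_path_neq us) lt_c).
by case=> e n /= h1 h2 f fe; apply: lt_trans h1; exact: h2.
Qed.

Lemma near_right_ex (R : realType) (I : Type) (F : set_system I)
    {FF : Filter F} (P : R -> I -> Prop) :
  (\forall e \near 0^'+ & i \near F, P e i) ->
  exists2 e, 0 < e & \forall i \near F, P e i.
Proof.
move=> [[U V] [/= nU nV] UV].
have [e [Ue e0]] := filter_ex (filterI nU (nbhs_right_gt (0 : R))).
by exists e => //; apply: filterS nV => i Vi; exact: (UV (e, i)).
Qed.

(* Between points of [Gamma n] close to those of [s], the geodesic order of
   [Gamma n] selects a permutation of [s], and there are finitely many. *)
Lemma geodesic_limit_path (R : realType)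
    (d_ : nat -> R * R -> R * R -> \bar R) (d : R * R -> R * R -> \bar R)
    (u_ v_ : nat -> R * R) (u v : R * R) (Gamma : nat -> set (R * R))
    (K : set (R * R)) (s : seq (R * R)) :
  (forall n, directed_metric (d_ n)) -> spacetime_metric d -> hypo_cvg d_ d ->
  d_ n (u_ n) (v_ n) @[n --> \oo] --> d u v ->
  (forall n, geodesic_set (d_ n) (u_ n) (v_ n) (Gamma n)) ->
  (forall e : R, 0 < e -> \forall n \near \oo, exists f,
     [/\ f u = u_ n, f v = v_ n &
         forall x, K x -> Gamma n (f x) /\ ball x e (f x)]) ->
  K u -> K v -> {in s, forall x, K x} -> uniq (u :: rcons s v) ->
  exists2 t, perm_eq t s & (d u v <= path_length d u (rcons t v))%E.
Proof.
move=> hd_ hd hcvg hduv hG hK Ku Kv sK us; apply: contrapT => nt.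
pose near_t t e n := forall f : R * R -> R * R,
  {in u :: rcons t v, forall x, ball x e (f x)} ->
  (path_length (d_ n) (f u) (map f (rcons t v)) < d_ n (u_ n) (v_ n))%E.
have : \forall e \near 0^'+ & n \near \oo,
    {in permutations s, forall t, near_t t e n}.
  refine (@filter_forall_seq _ (filter_prod (0 : R)^'+ \oo) _ _
    (fun t en => near_t t en.1 en.2) _ _) => t.
  rewrite mem_permutations => ts.
  apply: (hypo_cvg_path_lt (s := rcons t v) hd hcvg hduv).
    move: us => /=; rewrite !rcons_uniq !mem_rcons !inE.
    by rewrite !(perm_mem ts) (perm_uniq ts).
  by rewrite ltNge; apply/negP => le_t; apply: nt; exists t.
move=> /near_right_ex[e e0] /(filterI (hK e e0)).
move=> /filter_ex[n [[f [fu fv fK]] lt_s]].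
have [_ Gu Gv [le [tot leu lev dadd]]] := hG n.
pose r x y := `[< le x y >].
(* The points of [s] in the order in which the geodesic visits their images. *)
pose t := sort (relpre f r) s.
have ts : perm_eq t s by rewrite perm_sort.
have tK x : x \in t -> K x by rewrite (perm_mem ts); exact: sK.
have fuv x : x \in u :: rcons t v -> Gamma n (f x) /\ ball x e (f x).
  by rewrite inE mem_rcons inE => /or3P[/eqP->|/eqP->|/tK]; exact: fK.
have /lt_s/(_ f (fun x xs => (fuv x xs).2)) : t \in permutations s by rewrite mem_permutations.
have d0 a : d_ n a a = 0%E by have [] := hd_ n.
(* By additivity the image path has length exactly [d_ n (u_ n) (v_ n)], against the strict
   bound. *)
have [||_ <-] := @geodesic_set_path_length _ (d_ n) (Gamma n) le (f u) (map f (rcons t v))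
  d0 tot dadd.
- move=> x; rewrite -map_cons => /mapP[y yt ->].
  by have [] := fuv y yt.
- rewrite map_rcons rcons_path path_min_sorted.
    rewrite sorted_map; apply/andP; split.
      apply: (@sort_sorted_in _ (mem s)); last by apply/allP.
      move=> x y xs ys /=; have [_ _ _ tt] := tot.
      by apply/orP; have [] := tt _ _ (fK _ (sK _ xs)).1 (fK _ (sK _ ys)).1;
        [left|right]; apply/asboolP.
    apply/asboolP; rewrite fv; apply: lev.
    (* For empty [t] the point before [v] is [u] itself. *)
    have := mem_last u t; rewrite last_map inE => /predU1P[->|/tK/fK[]//].
    by rewrite fu.
  by apply/allP => _ /mapP[x xt ->]; apply/asboolP; rewrite fu; apply: leu; exact: (fK _ (tK _ xt)).1.
by rewrite map_rcons last_rcons fu fv ltxx.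
Qed.

(** * Geodesics of a spacetime metric *)

Section spacetime.
Variables (R : realType) (d : R * R -> R * R -> \bar R).
Hypothesis hd : spacetime_metric d.

Lemma spacetime_lt p q : (-oo < d p q)%E -> p = q \/ p.2 < q.2.
Proof.
move=> dpq; have [->|pq] := pselect (p = q); [by left|right].
rewrite ltNge; apply/negP => qp.
by move: dpq; rewrite (spacetime_ninfty hd pq qp) ltxx.
Qed.

Lemma spacetime_real p q : p.2 < q.2 -> exists r : R, d p q = r%:E.
Proof.
move=> /(spacetime_fin hd); have [/(_ p q) + _ _] := spacetime_directed hd.
by case: (d p q) => // r _ _; exists r.
Qed.

Lemma path_length_le p s : (path_length d p s <= d p (last p s))%E.
Proof.
elim: s p => [|q s IHs] p /=; first by rewrite (spacetime_diag hd).
have [_ _ dtri] := spacetime_directed hd.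
by apply: le_trans (dtri p q _); exact: leeD2l.
Qed.

(** A length above [-oo] forces every step above [-oo], hence forward in time. *)
Lemma path_length_sorted p s : (-oo < path_length d p s)%E ->
  path (fun x y => x != y) p s -> path (fun x y => x.2 < y.2) p s.
Proof.
elim: s p => [//|q s IHs] p /= /adde_gtNy[/spacetime_lt dpq ds] /andP[/eqP pq qs].
by rewrite IHs // andbT; case: dpq.
Qed.

(** Geodesic sets with time as the order. Without a quantifier over orders, the conditions pass to
    unions of chains. *)
Definition time_ordered p q (A : set (R * R)) :=
  [/\ A p, A q, (forall a, A a -> p.2 <= a.2 <= q.2),
      (forall a b, A a -> A b -> a.2 = b.2 -> a = b) &
      (forall a b c, A a -> A b -> A c -> a.2 <= b.2 -> b.2 <= c.2 ->
         d a c = (d a b + d b c)%E)].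

(** Additivity and [-oo < d p q] give [-oo < d a b] whenever [a] precedes [b], so [a = b] or [a] is
    earlier; totality gives the converse. *)
Lemma geodesic_set_time p q A : p.2 < q.2 ->
  geodesic_set d p q A <-> time_ordered p q A.
Proof.
move=> pq; split; last first.
  move=> [Ap Aq Apq Ainj Aadd]; split => //; first exact: (spacetime_fin hd).
  exists (fun a b => a.2 <= b.2); split => //.
  - split => //.
    + by move=> a b Aa Ab ab ba; apply: Ainj => //; apply/eqP; rewrite eq_le ab.
    + by move=> a b c _ _ _; exact: le_trans.
    + by move=> a b _ _; apply/orP; exact: le_total.
  - by move=> a /Apq/andP[].
  - by move=> a /Apq/andP[].
move=> [dpq Ap Aq [le [[rle ale tle tot] pA Aq' Aadd]]].
have le_time a b : A a -> A b -> le a b -> a = b \/ a.2 < b.2.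
  move=> Aa Ab ab; apply: spacetime_lt.
  move: dpq; rewrite (Aadd p a q Ap Aa Aq (pA _ Aa) (Aq' _ Aa)).
  move=> /adde_gtNy[_]; rewrite (Aadd a b q Aa Ab Aq ab (Aq' _ Ab)).
  by move=> /adde_gtNy[].
have time_le a b : A a -> A b -> a.2 <= b.2 -> le a b.
  move=> Aa Ab ab; have [//|/(le_time _ _ Ab Aa)[->|]] := tot a b Aa Ab; first exact: rle.
  by rewrite ltNge ab.
have wk a b : a = b \/ a.2 < b.2 -> a.2 <= b.2 by move=> [->|/ltW].
split => //.
- move=> a Aa; apply/andP; split; apply: wk; apply: le_time => //; [exact: pA|exact: Aq'].
- by move=> a b Aa Ab ab; apply: ale => //; apply: time_le; rewrite ?ab.
- by move=> a b c Aa Ab Ac ab bc; apply: Aadd => //; exact: time_le.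
Qed.

(** Zorn's lemma applies because each condition involves at most three points, which lie in one
    member of a chain. It is run on the sets [X] added to [A], so that the empty union is
    admissible. *)
Lemma geodesic_extend p q A : p.2 < q.2 -> time_ordered p q A ->
  exists2 B, geodesic d p q B & A `<=` B.
Proof.
move=> pq tA.
have [F FP Ftot|X [PX Xmax]] := @Zorn_bigcup _ [set X | time_ordered p q (A `|` X)].
  (* Adding [set0] provides a member for points of [A] even when the chain is empty. *)
  pose F' := F `|` [set set0].
  have F'P X : F' X -> time_ordered p q (A `|` X) by move=> [/FP//|->]; rewrite setU0.
  have F'tot X Y : F' X -> F' Y -> exists Z, [/\ F' Z, X `<=` Z & Y `<=` Z].
    move=> [FX|->] F'Y; last by exists Y; split.
    move: F'Y => [FY|->]; last by exists X; split => //; left.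
    by have [XY|YX] := Ftot _ _ FX FY; [exists Y|exists X]; split => //; left.
  have F'in a : (A `|` \bigcup_(X in F) X) a -> exists2 X, F' X & (A `|` X) a.
    move=> [Aa|[X FX Xa]]; first by exists set0; [right|left].
    by exists X; [left|right].
  have F'in3 a b c : (A `|` \bigcup_(X in F) X) a -> (A `|` \bigcup_(X in F) X) b ->
      (A `|` \bigcup_(X in F) X) c ->
      exists X, [/\ F' X, (A `|` X) a, (A `|` X) b & (A `|` X) c].
    move=> /F'in[X F'X Xa] /F'in[Y F'Y Yb] /F'in[Z F'Z Zc].
    have [T [F'T XT YT]] := F'tot _ _ F'X F'Y.
    have [W [F'W TW ZW]] := F'tot _ _ F'T F'Z.
    exists W; split => //.
    - by case: Xa => [|/XT/TW]; [left|right].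
    - by case: Yb => [|/YT/TW]; [left|right].
    - by case: Zc => [|/ZW]; [left|right].
  have [Ap Aq _ _ _] := tA.
  split; [by left|by left| | |].
  - by move=> a Fa; have [X [/F'P[_ _ h _ _] Xa _ _]] := F'in3 _ _ _ Fa Fa Fa; exact: h.
  - by move=> a b Fa Fb; have [X [/F'P[_ _ _ h _] Xa Xb _]] := F'in3 _ _ _ Fa Fb Fb; exact: h.
  - by move=> a b c Fa Fb Fc; have [X [/F'P[_ _ _ _ h] Xa Xb Xc]] := F'in3 _ _ _ Fa Fb Fc; exact: h.
exists (A `|` X); last by move=> x; left.
split; first exact/geodesic_set_time.
move=> B /(geodesic_set_time _ pq) tB AXB; apply: contrapT => BAX.
apply: (Xmax B); last by rewrite /= setUidr // => x Ax; apply: AXB; left.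
split; first by move=> x Xx; apply: AXB; right.
move=> BX; apply: BAX; apply/seteqP; split => // x Bx; right; exact: BX.
Qed.

(* Points of a geodesic set have distinct times in [p.2, q.2], so a set taking
   all these times cannot be enlarged. *)
Lemma time_ordered_geodesic p q A : p.2 < q.2 -> time_ordered p q A ->
  (forall r, p.2 < r < q.2 -> exists2 a, A a & a.2 = r) -> geodesic d p q A.
Proof.
move=> pq tA Ar; split; first exact/geodesic_set_time.
move=> B /(geodesic_set_time _ pq)[Bp Bq Bpq Binj _] AB.
have [Ap Aq _ _ _] := tA.
apply/seteqP; split => // b Bb.
have [a Aa ab] : exists2 a, A a & a.2 = b.2.
  have /andP[] := Bpq b Bb.
  rewrite le_eqVlt => /predU1P[<-|pb]; first by exists p.
  rewrite le_eqVlt => /predU1P[->|bq]; first by exists q.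
  by apply: Ar; rewrite pb.
by rewrite -(Binj a b (AB _ Aa) Bb ab).
Qed.

(** Such a [z] makes [[set p; z; q]] a geodesic set, which extends to a geodesic and so lies in the
    box of [spacetime_geodesics]. *)
Lemma geodesic_point_bounded p q : p.2 < q.2 -> exists M : R,
  [/\ `|p| <= M, `|q| <= M &
      forall z, p.2 < z.2 < q.2 -> d p q = (d p z + d z q)%E -> `|z| <= M].
Proof.
move=> pq; have [a [b hab]] : exists a b : R,
    forall A, geodesic d p q A -> A `<=` `[a, b] `*` `[p.2, q.2].
  by case: p q pq => x s [y t]; exact: (spacetime_geodesics hd).
pose M := `|a| + `|b| + `|p.2| + `|q.2|.
have boxM z : (`[a, b] `*` `[p.2, q.2]) z -> `|z| <= M.
  case: z => x s; rewrite /= !in_itv /= => -[/andP[ax xb] /andP[ps sq]].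
  rewrite /M ge_max /=; have := (ler_norm b, ler_norm q.2, lerNnormlW (lexx `|a|), lerNnormlW (lexx `|p.2|)).
  have := (normr_ge0 a, normr_ge0 b, normr_ge0 p.2, normr_ge0 q.2).
  by move=> [[[? ?] ?] ?] [[[? ?] ?] ?]; rewrite !ler_norml; lra.
have through z : p.2 < z.2 < q.2 -> d p q = (d p z + d z q)%E ->
    [/\ `|p| <= M, `|z| <= M & `|q| <= M].
  move=> /andP[pz zq] dpq; have d0 := spacetime_diag hd.
  have [|A gA sA] := @geodesic_extend p q [set p; z; q] pq.
    split; [by left; left|by right| | |].
    - by move=> _ [[->|->]|->]; lra.
    - by move=> _ _ [[->|->]|->] [[->|->]|->] // h; exfalso; lra.
    - move=> _ _ _ [[->|->]|->] [[->|->]|->] [[->|->]|->] h1 h2;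
        rewrite ?d0 ?add0e ?adde0 //; exfalso; lra.
  by split; apply: boxM; apply: (hab A gA); apply: sA; [left; left|left; right|right].
(* A splitting point at the middle time shows that some geodesic exists, which puts [p] and [q] in
   the box. *)
exists M; have [z pzq dpq] : exists2 z, p.2 < z.2 < q.2 & d p q = (d p z + d z q)%E.
  case: p q pq {hab M boxM through} => x s [y t] /= st.
  have [|| _ [z dz]] := spacetime_max hd x y (s := s) (t := t) (r := (s + t) / 2); try lra.
  by exists (z, (s + t) / 2) => //=; lra.
have [pM _ qM] := through z pzq dpq.
by split => // w pwq dw; have [] := through w pwq dw.
Qed.

End spacetime.

(** * Compactness and connectedness in the plane *)

Lemma near_compact_disjoint (R : realType) (T : Type) (F : set_system T)
    {FF : Filter F} (A : T -> set (R * R)) (C : set (R * R)) : compact C ->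
  (forall x, C x -> \forall y \near x & i \near F, ~ A i y) ->
  \forall i \near F, forall x, C x -> ~ A i x.
Proof.
by move=> Cco CA; exact: ((compact_near_coveringP _).1 Cco _ F (fun i x => ~ A i x)).
Qed.

Lemma compact_bounded_plane (R : realType) (M : R) (D : set (R * R)) :
  closed D -> compact [set z : R * R | `|z| <= M /\ D z].
Proof.
move=> Dcl; have Mco : compact (`[- M, M]%classic `*` `[- M, M]%classic : set (R * R)).
  by apply: compact_setX; exact: segment_compact.
apply: (subclosed_compact _ Mco).
  apply: closedI => //; apply: (@closed_comp _ _ (@Num.norm R (R * R)%type) [set x | x <= M]).
    by move=> x _; exact: norm_continuous.
  exact: closed_le.
case=> x y [/=]; rewrite ge_max /= => /andP[xM yM] _.
by rewrite !in_itv /= -!ler_norml xM yM.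
Qed.

Lemma connected_value (R : realType) (A : set (R * R)) (f : R * R -> R)
    (p q : R * R) (r : R) : connected A -> continuous f -> A p -> A q ->
  f p <= r <= f q -> exists2 z, A z & f z = r.
Proof.
move=> Aco fco Ap Aq pqr.
have /connected_intervalP fA : connected (f @` A).
  by apply: connected_continuous_connected => //; exact: continuous_subspaceT.
by have [z Az zr] := fA (f p) (f q) (imageP _ Ap) (imageP _ Aq) _ pqr; exists z.
Qed.

(** * Limits of connected geodesics *)

Section limit_of_geodesics.
Variables (R : realType) (d_ : nat -> R * R -> R * R -> \bar R).
Variables (d : R * R -> R * R -> \bar R) (u_ v_ : nat -> R * R) (u v : R * R).
Variable Gamma : nat -> set (R * R).
Hypothesis hd_ : forall n, directed_metric (d_ n).
Hypothesis hd : spacetime_metric d.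
Hypothesis hcvg : hypo_cvg d_ d.
Hypothesis huv : u.2 < v.2.
Hypothesis hu : u_ n @[n --> \oo] --> u.
Hypothesis hv : v_ n @[n --> \oo] --> v.
Hypothesis hGamma : forall n, geodesic_set (d_ n) (u_ n) (v_ n) (Gamma n).
Hypothesis hconn : forall n, connected (Gamma n).
Hypothesis hduv : d_ n (u_ n) (v_ n) @[n --> \oo] --> d u v.

Let uv_neq : u != v.
Proof. by apply/eqP => uv; move: huv; rewrite uv ltxx. Qed.

(** A point [z'] of [Gamma n] near [z] would make the path [u_ n], [z'], [v_ n] as long as
    [d_ n (u_ n) (v_ n)], which semicontinuity along [u], [z], [v] forbids. *)
Lemma geodesics_avoid z : z != u -> z != v -> (d u z + d z v < d u v)%E ->
  \forall z' \near z & n \near \oo, ~ Gamma n z'.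
Proof.
move=> zu zv ltd.
have uzv : uniq [:: u; z; v] by rewrite /= !inE negb_or uv_neq zv eq_sym zu.
have ltd' : (path_length d u [:: z; v] < d u v)%E by rewrite /= adde0.
have [e e0 He] := near_right_ex (hypo_cvg_path_lt hd hcvg hduv uzv ltd').
exists (ball z e, [set n | [/\ ball u e (u_ n), ball v e (v_ n) &
  forall f : R * R -> R * R, {in [:: u; z; v], forall x, ball x e (f x)} ->
    (path_length (d_ n) (f u) (map f [:: z; v]) < d_ n (u_ n) (v_ n))%E]]).
  split; first exact: nbhsx_ballx.
  have bu : \forall n \near \oo, ball u e (u_ n) by exact: cvg_ball hu _ e0.
  have bv : \forall n \near \oo, ball v e (v_ n) by exact: cvg_ball hv _ e0.
  by apply: filterS3 bu bv He => n.
case=> z' n /= [zz' [uu' vv' hlt]] Gz'.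
pose f x := if x == u then u_ n else if x == v then v_ n else z'.
have fu : f u = u_ n by rewrite /f eqxx.
have fv : f v = v_ n by rewrite /f eqxx eq_sym (negbTE uv_neq).
have fz : f z = z' by rewrite /f (negbTE zu) (negbTE zv).
have := hlt f; rewrite /= fu fv fz adde0.
have [_ Gu Gv [le [_ leu lev dadd]]] := hGamma n.
rewrite -(dadd _ _ _ Gu Gz' Gv) ?ltxx; [|exact: leu|exact: lev].
suff H : {in [:: u; z; v], forall x, ball x e (f x)} by move=> /(_ H).
by move=> x; rewrite !inE => /or3P[]/eqP->; rewrite ?fu ?fv ?fz.
Qed.

Lemma geodesics_bounded : exists M : R,
  \forall n \near \oo, forall z, Gamma n z -> `|z| <= M.
Proof.
have [M [uM vM hM]] := geodesic_point_bounded hd huv.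
exists (M + 1).
(* The sphere of radius [M + 1]: splitting points stay within [M], and [u_ n] is eventually strictly
   inside. *)
have Sco : compact [set z : R * R | `|z| <= M + 1 /\ M + 1 <= `|z|].
  apply: (@compact_bounded_plane _ _ [set z : R * R | M + 1 <= `|z|]).
  apply: (@closed_comp _ _ (@Num.norm R (R * R)%type) [set x | M + 1 <= x]).
    by move=> x _; exact: norm_continuous.
  exact: closed_ge.
have Sav : \forall n \near \oo, forall z, `|z| <= M + 1 /\ M + 1 <= `|z| -> ~ Gamma n z.
  apply: (near_compact_disjoint (A := Gamma) Sco) => z [_ Mz].
  have zu : z != u by apply/eqP => zu; move: Mz; rewrite zu; lra.
  have zv : z != v by apply/eqP => zv; move: Mz; rewrite zv; lra.
  apply: geodesics_avoid => //; rewrite lt_neqAle; apply/andP; split; last first.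
    by have [_ _] := spacetime_directed hd; exact.
  (* Equality and finiteness of [d u v] would place [z] strictly between [u] and [v] in time, hence
     within radius [M]. *)
  apply/eqP => duzv; have := spacetime_fin hd huv; rewrite -duzv.
  move=> /adde_gtNy[/(spacetime_lt hd) uz /(spacetime_lt hd) zv'].
  have uzv : u.2 < z.2 < v.2.
    by apply/andP; split; [case: uz zu|case: zv' zv] => // ->; rewrite eqxx.
  by have := hM z uzv (esym duzv); lra.
have uB : \forall n \near \oo, `|u_ n| < M + 1.
  by apply: (cvgr_norm_lt _ hu); lra.
apply: filterS2 Sav uB => n nS un z Gz; rewrite leNgt; apply/negP => Mz.
have [_ Gu _ _] := hGamma n.
have uMz : `|u_ n| <= M + 1 <= `|z| by rewrite !ltW.
have [w Gw wM] := connected_value (f := @Num.norm R (R * R)%type)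
  (@hconn n) (@norm_continuous _ _) Gu Gz uMz.
by apply: (nS w) => //; rewrite wM.
Qed.

Variable K : hyperspace R.
Hypothesis hK : hyper_closure (Gamma n) @[n --> \oo] --> K.

Lemma limit_endpoint (w_ : nat -> R * R) w : w_ n @[n --> \oo] --> w ->
  (forall n, Gamma n (w_ n)) -> hyperspace_set K w.
Proof.
move=> hw Gw; apply: (edist2_lt_closed (@hyperspace_closed _ K)) => e e0.
have e20 : 0 < e / 2 by rewrite divr_gt0.
have [n [/hyperspace_ballP[r [_ re _ GK]] ww]] :=
  filter_ex (filterI (cvg_ball hK e20) (hw _ (near_edist2 w e20))).
have [y Ky wy] := GK _ (subset_closure (Gw n)).
by exists y => //; apply: le_lt_trans (edist2_triangle w (w_ n) y) _; rewrite /= in ww; lra.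
Qed.

Let Ku : hyperspace_set K u.
Proof. by apply: (limit_endpoint hu) => n; have [] := hGamma n. Qed.

Let Kv : hyperspace_set K v.
Proof. by apply: (limit_endpoint hv) => n; have [] := hGamma n. Qed.

(** Points of [K] are close to the closure of [Gamma n], hence to [Gamma n]. Sending [u] and [v] to
    the exact endpoints makes the image of a path from [u] to [v] run from [u_ n] to [v_ n]. *)
Lemma limit_approx (e : R) : 0 < e -> \forall n \near \oo, exists f,
  [/\ f u = u_ n, f v = v_ n &
      forall x, hyperspace_set K x -> Gamma n (f x) /\ ball x e (f x)].
Proof.
move=> e0; have e20 : 0 < e / 2 by rewrite divr_gt0.
have bu : \forall n \near \oo, ball u e (u_ n) by exact: cvg_ball hu _ e0.
  have bv : \forall n \near \oo, ball v e (v_ n) by exact: cvg_ball hv _ e0.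
apply: filterS3 bu bv (cvg_ball hK e20) => n uu vv /hyperspace_ballP[r [r0 re KG _]].
have [_ Gu Gv _] := hGamma n.
have /choice[g gP] : forall x, exists y, hyperspace_set K x -> Gamma n y /\ ball x e y.
  move=> x; have [Kx|nKx] := pselect (hyperspace_set K x); last by exists x.
  have [y Gy xy] := KG x Kx; have [z Gz yz] := edist2_lt_closure Gy e20.
  exists z => _; split => //; apply: ball_edist2.
  by apply: le_lt_trans (edist2_triangle x y z) _; lra.
exists (fun x => if x == u then u_ n else if x == v then v_ n else g x).
rewrite !eqxx eq_sym (negbTE uv_neq); split => // x Kx.
by case: eqP => [->//|_]; case: eqP => [->//|_]; exact: gP.
Qed.

(** The triangle inequality of [d] turns the bound of [geodesic_limit_path] into an equality, and
    finiteness of [d u v] makes times increase along the path. *)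
Let limit_path s : {in s, forall x, hyperspace_set K x} ->
  uniq (u :: rcons s v) ->
  exists t, [/\ perm_eq t s, path (fun x y => x.2 < y.2) u (rcons t v) &
    d u v = path_length d u (rcons t v)].
Proof.
move=> sK us; have [t ts le_t] := geodesic_limit_path hd_ hd hcvg hduv
  hGamma limit_approx Ku Kv sK us.
exists t; split => //; last first.
  by apply/eqP; rewrite eq_le le_t -[in d u v](last_rcons u t v) path_length_le.
apply: (path_length_sorted hd); first exact: lt_le_trans (spacetime_fin hd huv) le_t.
apply: uniq_path_neq; move: us => /=; rewrite !rcons_uniq !mem_rcons !inE.
by rewrite !(perm_mem ts) (perm_uniq ts).
Qed.

(** Only one arrangement of the points has strictly increasing times, so the permutation is
    trivial. *)
Let limit_path_sorted s : {in s, forall x, hyperspace_set K x} ->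
  path (fun x y => x.2 < y.2) u (rcons s v) ->
  d u v = path_length d u (rcons s v).
Proof.
have tr : transitive (fun x y : R * R => x.2 < y.2) by move=> y x z; exact: lt_trans.
have irr : irreflexive (fun x y : R * R => x.2 < y.2) by move=> x; exact: ltxx.
move=> sK us; have [|t [ts ut ->]] := limit_path sK.
  exact: (@sorted_uniq _ _ tr irr (u :: rcons s v)).
have -> // : t = s.
apply: (@sorted_eq _ (fun x y : R * R => x.2 < y.2)) => //.
- by move=> x y /andP[xy yx]; have := lt_trans xy yx; rewrite ltxx.
- by move: ut; rewrite rcons_path => /andP[/path_sorted].
- by move: us; rewrite rcons_path => /andP[/path_sorted].
Qed.

Lemma limit_time_ordered : time_ordered d u v K.
Proof.
have Kint a : hyperspace_set K a -> [\/ a = u, a = v | u.2 < a.2 < v.2].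
  move=> Ka; have [->|au] := eqVneq a u; first by constructor 1.
  have [->|av] := eqVneq a v; first by constructor 2.
  constructor 3; have [||t [ta + _]] := @limit_path [:: a].
  - by move=> x; rewrite inE => /eqP->.
  - by rewrite /= !inE negb_or uv_neq av eq_sym au.
  by rewrite (perm_small_eq _ ta)//= andbT.
have Ktime a : hyperspace_set K a -> u.2 <= a.2 <= v.2.
  by move=> /Kint[->|->|/andP[ua av]]; rewrite ?lexx ?(ltW huv) ?(ltW ua) ?(ltW av).
have Kinj a b : hyperspace_set K a -> hyperspace_set K b -> a.2 = b.2 -> a = b.
  move=> Ka Kb ab.
  case: (Kint a Ka) => [au|av|/andP[ua av]]; case: (Kint b Kb) => [bu|bv|/andP[ub bv]];
    first [by rewrite au bu | by rewrite av bv
      | by move: huv; rewrite -au -bv ab ltxx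
      | by move: huv; rewrite -av -bu ab ltxx
      | by move: ub; rewrite -ab au ltxx | by move: bv; rewrite -ab av ltxx
      | by move: ua; rewrite ab bu ltxx | by move: av; rewrite ab bv ltxx | idtac].
  (* Two distinct interior points would occur on one path with strictly increasing times. *)
  apply: contrapT => /eqP nab.
  have neq (x y : R * R) : x.2 < y.2 -> (x != y) * (y != x).
    by move=> xy; split; apply/eqP => exy; move: xy; rewrite exy ltxx.
  have [||t [tab + _]] := @limit_path [:: a; b].
  - by move=> x; rewrite !inE => /orP[]/eqP->.
  - rewrite /= !inE !negb_or uv_neq nab.
    by rewrite !(neq _ _ ua) !(neq _ _ ub) !(neq _ _ av) !(neq _ _ bv).
  have : uniq t by rewrite (perm_uniq tab) /= inE nab.
  have := perm_mem tab; have := perm_size tab.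
  case: t {tab} => [|x [|y []]] //= _ txy /andP[]; rewrite inE => xy _ /and4P[_ xy2 _ _].
  have := txy x; have := txy y; rewrite !inE !eqxx ?orbT => /esym/orP[]/eqP yE /esym/orP[]/eqP xE;
    by move: xy2; rewrite xE yE ?ab ltxx.
split => // a b c Ka Kb Kc; have d0 := spacetime_diag hd.
rewrite le_eqVlt => /predU1P[/(Kinj _ _ Ka Kb)->|ab]; first by rewrite d0 add0e.
rewrite le_eqVlt => /predU1P[/(Kinj _ _ Kb Kc)->|bc]; first by rewrite d0 adde0.
have [r1 dab] := spacetime_real hd ab; have [r2 dbc] := spacetime_real hd bc.
have [r3 dac] := spacetime_real hd (lt_trans ab bc).
have [r4 duv] := spacetime_real hd huv.
(* Additivity on [a], [b], [c] comes from cancelling finite terms between the decompositions of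
   [d u v] with and without [b]. When [a = u] or [c = v] the path has fewer interior points, hence
   three versions. *)
have P1 x : hyperspace_set K x -> u.2 < x.2 -> x.2 < v.2 ->
    d u v = (d u x + d x v)%E.
  move=> Kx ux xv; rewrite (@limit_path_sorted [:: x]) /= ?ux ?xv ?adde0 //.
  by move=> y; rewrite inE => /eqP->.
have P2 x y : hyperspace_set K x -> hyperspace_set K y -> u.2 < x.2 ->
    x.2 < y.2 -> y.2 < v.2 -> d u v = (d u x + (d x y + d y v))%E.
  move=> Kx Ky ux xy yv; rewrite (@limit_path_sorted [:: x; y]) /= ?ux ?xy ?yv ?adde0 //.
  by move=> z; rewrite !inE => /orP[]/eqP->.
have P3 : u.2 < a.2 -> c.2 < v.2 -> d u v = (d u a + (d a b + (d b c + d c v)))%E.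
  move=> ua cv; rewrite (@limit_path_sorted [:: a; b; c]) /= ?ua ?ab ?bc ?cv ?adde0 //.
  by move=> z; rewrite !inE => /or3P[]/eqP->.
case: (Kint a Ka) => [au|av|/andP[ua av]].
- subst a.
  case: (Kint c Kc) => [cu|cv|/andP[uc cv]]; first by have := lt_trans ab bc; rewrite cu ltxx.
    by subst c; exact: P1.
  have := P2 b c Kb Kc ab bc cv; rewrite (P1 c Kc uc cv).
  have [r5 ->] := spacetime_real hd cv; rewrite dab dbc dac -!EFinD => -[] ?.
  by congr EFin; lra.
- by have /andP[_] := Ktime b Kb; rewrite leNgt -av ab.
case: (Kint c Kc) => [cu|cv|/andP[uc cv]].
- by have /andP[] := Ktime b Kb; rewrite leNgt -cu bc.
- subst c.
  have := P2 a b Ka Kb ua ab bc; rewrite (P1 a Ka ua av).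
  have [r5 ->] := spacetime_real hd ua; rewrite dab dbc dac -!EFinD => -[] ?.
  by congr EFin; lra.
have := P3 ua cv; rewrite (P2 a c Ka Kc ua (lt_trans ab bc) cv).
have [r5 ->] := spacetime_real hd ua; have [r6 ->] := spacetime_real hd cv.
by rewrite dab dbc dac -!EFinD => -[] ?; congr EFin; lra.
Qed.

(** If [K] missed time [r], the compact slice at that time would eventually be avoided by [Gamma n],
    which must cross it by connectedness. *)
Lemma limit_time_surj r : u.2 < r < v.2 -> exists2 a, hyperspace_set K a & a.2 = r.
Proof.
move=> /andP[ur rv]; apply: contrapT => nr.
have [M GM] := geodesics_bounded.
have sndc : continuous (fun z : R * R => z.2) by move=> z; exact: cvg_snd.
have Cco : compact [set z : R * R | `|z| <= M /\ z.2 = r].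
  apply: (@compact_bounded_plane _ _ [set z : R * R | z.2 = r]).
  apply: (@closed_comp _ _ (fun z : R * R => z.2) [set x | x = r]); last exact: closed_eq.
  by move=> x _; exact: sndc.
have Cav : \forall n \near \oo, forall z, `|z| <= M /\ z.2 = r -> ~ Gamma n z.
  apply: (near_compact_disjoint (A := Gamma) Cco) => z [_ zr].
  (* A point off the closed set [K] has positive distance from it. *)
  have [e [e0 he]] : exists e, 0 < e /\ forall a, hyperspace_set K a -> e <= edist2 z a.
    apply: contrapT => ne; apply: nr; exists z => //.
    apply: (edist2_lt_closed (@hyperspace_closed _ K)) => e e0; apply: contrapT => na.
    apply: ne; exists e; split => // a Ka; rewrite leNgt; apply/negP => za.
    by apply: na; exists a.
  have e20 : 0 < e / 2 by rewrite divr_gt0.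
  exists ([set z' | edist2 z z' < e / 2], [set n | ball K (e / 2) (hyper_closure (Gamma n))]).
    by split; [exact: near_edist2 | exact: (cvg_ball hK e20)].
  case=> z' n /= [zz' /hyperspace_ballP[s [_ se _ GK]]] Gz'.
  have [a Ka z'a] := GK _ (subset_closure Gz').
  by have := he a Ka; have := edist2_triangle z z' a; lra.
have sndu : (u_ n).2 @[n --> \oo] --> u.2.
  exact: (@continuous_cvg _ _ _ _ _ u_ (fun z : R * R => z.2) u (sndc u) hu).
have sndv : (v_ n).2 @[n --> \oo] --> v.2.
  exact: (@continuous_cvg _ _ _ _ _ v_ (fun z : R * R => z.2) v (sndc v) hv).
have nu : \forall n \near \oo, (u_ n).2 < r.
  by apply: (sndu [set x | x < r]); exact: lt_nbhsl.
have nv : \forall n \near \oo, r < (v_ n).2.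
  by apply: (sndv [set x | r < x]); exact: lt_nbhsr.
have [n [[Gn Cn] [un vn]]] := filter_ex (filterI (filterI GM Cav) (filterI nu nv)).
have [_ Gu Gv _] := hGamma n.
have unv : (u_ n).2 <= r <= (v_ n).2 by rewrite !ltW.
have [z Gz zr] := connected_value (f := fun z : R * R => z.2)
  (@hconn n) sndc Gu Gv unv.
by apply: (Cn z) => //; split => //; exact: Gn.
Qed.

Lemma limit_geodesic : geodesic d u v K.
Proof.
by apply: time_ordered_geodesic => //; [exact: limit_time_ordered|exact: limit_time_surj].
Qed.

End limit_of_geodesics.

Theorem theorem8p5 (R : realType)
    (d_ : nat -> R * R -> R * R -> \bar R) (d : R * R -> R * R -> \bar R)
    (u_ v_ : nat -> R * R) (u v : R * R) (Gamma : nat -> set (R * R))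
    (hd_ : forall n, directed_metric (d_ n))
    (hd : spacetime_metric d)
    (hcvg : hypo_cvg d_ d)
    (huv : u.2 < v.2)
    (hu : u_ n @[n --> \oo] --> u)
    (hv : v_ n @[n --> \oo] --> v)
    (hGamma : forall n, geodesic (d_ n) (u_ n) (v_ n) (Gamma n))
    (hconn : forall n, connected (Gamma n))
    (hduv : d_ n (u_ n) (v_ n) @[n --> \oo] --> d u v) :
  precompact (range (fun n => hyper_closure (Gamma n))) /\
  (forall (phi : nat -> nat) (K : hyperspace R), increasing_seq phi ->
     hyper_closure (Gamma (phi k)) @[k --> \oo] --> K ->
     geodesic d u v K).
Proof.
have hG n : geodesic_set (d_ n) (u_ n) (v_ n) (Gamma n) by have [] := hGamma n.
split.
  have [M GM] := geodesics_bounded hd hcvg huv hu hv hG hconn hduv.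
  have Bco := @compact_bounded_plane R M setT closedT.
  apply: (precompact_range Bco); apply: filterS GM => n GM z /= Gz; split => //.
  have cl : closed [set z : R * R | `|z| <= M].
    apply: (@closed_comp _ _ (@Num.norm R (R * R)%type) [set x | x <= M]).
      by move=> x _; exact: norm_continuous.
    exact: closed_le.
  by apply: cl; apply: closureS Gz.
move=> phi K phi_inc hK.
have hphi : phi n @[n --> \oo] --> \oo.
  move=> A [N _ NA]; exists N => // n /= Nn; apply: NA => /=.
  apply: (leq_trans Nn).
  elim: n {Nn} => // n IHn; apply: (leq_ltn_trans IHn).
  by rewrite ltnNge -leEnat phi_inc ltnn.
(* Every hypothesis passes to the subsequence, so the result on full limits applies to it. *)
apply: (@limit_geodesic _ (d_ \o phi) d (u_ \o phi) (v_ \o phi) u v (Gamma \o phi)) => //.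
- by move=> n; exact: hd_.
- exact: (cvg_comp _ _ hphi hcvg).
- exact: (cvg_comp _ _ hphi hu).
- exact: (cvg_comp _ _ hphi hv).
- by move=> n; exact: hG.
- by move=> n; exact: hconn.
- exact: (cvg_comp _ _ hphi hduv).
Qed.
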